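(* Let $f(t)=\int_{\mathbb{Z}_p}w^ae^{at}\,\mathrm{d}\mu_{-1}(a)$. For every polynomial $h(x)\in\mathbb{C}_p[x]$, $$\langle f(t)|h(x)\rangle=\int_{\mathbb{Z}_p}w^ah(a)\,\mathrm{d}\mu_{-1}(a)$$ and $$\biggl\langle\frac{2}{we^{t}+1}\bigg|h(x)\biggr\rangle=\int_{\mathbb{Z}_p}w^ah(a)\,\mathrm{d}\mu_{-1}(a),$$ and for every $n\ge 0$, $$E_{n,w}=\biggl\langle\int_{\mathbb{Z}_p}w^ae^{at}\,\mathrm{d}\mu_{-1}(a)\bigg|x^n\biggr\rangle.$$
   Context: Let $p$ be a fixed odd prime, $\mathbb{C}_p$ the completion of an algebraic closure of $\mathbb{Q}_p$ with absolute value normalized by $|p|_p=p^{-1}$, and let $w\in\mathbb{C}_p$ satisfy $|1-w|_p<1$. For a uniformly differentiable function $F:\mathbb{Z}_p\to\mathbb{C}_p$, the fermionic $p$-adic integral is $\int_{\mathbb{Z}_p}F(a)\,\mathrm{d}\mu_{-1}(a)=\lim_{N\to\infty}\sum_{a=0}^{p^N-1}F(a)(-1)^a$. The expression $\int_{\mathbb{Z}_p}w^ae^{at}\,\mathrm{d}\mu_{-1}(a)$ denotes the formal power series $\sum_{n\ge0}\bigl[\int_{\mathbb{Z}_p}w^aa^n\,\mathrm{d}\mu_{-1}(a)\bigr]\frac{t^n}{n!}$. The weighted Euler polynomials $E_{n,w}(x)$ ($n\ge 0$) are defined by $\frac{2}{we^t+1}e^{xt}=\sum_{n=0}^\infty E_{n,w}(x)\frac{t^n}{n!}$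 (as formal power series), and the weighted Euler numbers are $E_{n,w}=E_{n,w}(0)$. A formal power series $f(t)=\sum_{k\ge 0}a_k\frac{t^k}{k!}$ with coefficients in $\mathbb{C}_p$ acts as a linear functional on $\mathbb{C}_p[x]$ by $\langle f(t)|x^n\rangle=a_n$ for all $n\ge 0$. *)

(* Defs.v *)
From HB Require Import structures.
From mathcomp Require Import all_boot all_order all_algebra.
From mathcomp Require Import all_classical all_reals all_analysis.

Set Implicit Arguments.
Unset Strict Implicit.
Unset Printing Implicit Defensive.

Import Order.TTheory GRing.Theory Num.Theory.

Local Open Scope classical_set_scope.
Local Open Scope ring_scope.

(* Complete ultrametric fields with |p| = 1/p; for p prime the absolute value
   extends the p-adic one of rat.  Such fields are not normedZmodTypes, where
   `|x *+ n| = `|x| *+ n.  The uniform structure is that of the metric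
   vabs (x - y); MathComp-Analysis has no join of Field with PseudoMetric or with
   Complete, whence the axioms entourage_vabs and padic_complete. *)
HB.mixin Record isPadicValued (R : realType) (p : nat) K
    & GRing.Field K & Uniform K := {
  vabs : K -> R;
  vabs_ge0 : forall x : K, 0 <= vabs x;
  vabs_eq0 : forall x : K, vabs x = 0 <-> x = 0;
  vabsM : {morph vabs : x y / x * y};
  vabs_ultra : forall x y : K, vabs (x + y) <= Num.max (vabs x) (vabs y);
  vabs_p : vabs p%:R = p%:R^-1;
  entourage_vabs :
    entourage = entourage_ (fun (x : K) (e : R) => [set y | vabs (x - y) < e]);
  padic_complete : forall F : set_system K,
    ProperFilter F -> cauchy F -> exists l : K, F --> l
}.

#[short(type="padicValuedFieldType")]
HB.structure Definition PadicValuedField (R : realType) (p : nat) :=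
  { K of GRing.Field K & Uniform K & isPadicValued R p K }.

(* As K is complete, the closure of its prime field is the completion Q_p. *)
Definition padic_number {R : realType} {p : nat}
    (K : padicValuedFieldType R p) : set K :=
  closure (range (fun q : rat => ratr q : K)).
Arguments padic_number {R p} K _.

Definition padic_int {R : realType} {p : nat}
    (K : padicValuedFieldType R p) : set K :=
  [set x | padic_number K x /\ vabs x <= 1].
Arguments padic_int {R p} K _.

Definition padic_algebraic {R : realType} {p : nat}
    (K : padicValuedFieldType R p) : set K :=
  [set x | exists q : {poly K},
     [/\ q != 0, forall i, padic_number K q`_i & root q x]].
Arguments padic_algebraic {R p} K _.

(* C_p, up to isometric isomorphism: the completion of an algebraic closure of
   Q_p.  An algebraic closure of Q_p inside K is necessarily padic_algebraic K,
   so the axioms say that this subfield is algebraically closed and that K is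
   its completion. *)
HB.mixin Record isPadicComplex (R : realType) (p : nat) K
    & PadicValuedField R p K := {
  padic_algebraic_closed : forall q : {poly K},
    (forall i, padic_algebraic K q`_i) -> (1 < size q)%N ->
    exists2 x, padic_algebraic K x & root q x;
  padic_algebraic_dense : dense (padic_algebraic K)
}.

#[short(type="padicComplexType")]
HB.structure Definition PadicComplex (R : realType) (p : nat) :=
  { K of PadicValuedField R p K & isPadicComplex R p K }.

Section padic_integral.
Context {R : realType} {p : nat} {K : padicValuedFieldType R p}.

Lemma vabs1 : vabs (1 : K) = 1.
Proof.
have n0 : vabs (1 : K) != 0.
  by apply/eqP => /vabs_eq0/eqP; rewrite oner_eq0.
by apply: (mulfI n0); rewrite -vabsM !mulr1.
Qed.

Lemma vabs_nat n : vabs (n%:R : K) <= 1.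
Proof.
elim: n => [|n IHn].
  by have /vabs_eq0 -> := erefl (0 : K).
by rewrite -natr1 (le_trans (vabs_ultra _ _)) // ge_max IHn vabs1 lexx.
Qed.

Lemma nat_padic_int n : (n%:R : K) \in padic_int K.
Proof.
rewrite inE; split; last exact: vabs_nat.
apply: subset_closure; exists n%:R => //.
by rewrite -[n%:R]/((n%:Z)%:~R) /ratr numq_int denq_int divr1.
Qed.

Definition padic_int_nat (n : nat) : padic_int K :=
  exist _ n%:R (nat_padic_int n).

(* The limit of a sequence, with junk value 0 if it diverges: [limn] itself needs
   a canonical point, and no structure combines Pointed with Field. *)
Definition padic_lim (u : nat -> K) : K :=
  xget 0 [set l | u n @[n --> \oo] --> l].

Definition fermionic_sum (F : padic_int K -> K) (N : nat) : K :=
  \sum_(0 <= a < (p ^ N)%N) F (padic_int_nat a) * (-1) ^+ a.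

Definition fermionic_integral (F : padic_int K -> K) : K :=
  padic_lim (fermionic_sum F).

Definition gbinom (x : K) (k : nat) : K :=
  (\prod_(i < k) (x - i%:R)) / k`!%:R.

(* w ^ a for a in Z_p and |1 - w| < 1: the continuous extension of n |-> w ^+ n,
   given by the binomial series of (1 + (w - 1)) ^ a. *)
Definition padic_pow (w : K) (a : padic_int K) : K :=
  padic_lim (series (fun k => gbinom (val a) k * (w - 1) ^+ k)).

End padic_integral.

(* Formal power series in t, as the sequence of the coefficients of t ^ n. *)
Definition fps (A : Type) := nat -> A.

Section fps.
Context {A : comUnitRingType}.
Implicit Types f g : fps A.

Definition fps_const (c : A) : fps A := fun n => if n is _.+1 then 0 else c.

Definition fps_add f g : fps A := fun n => f n + g n.

Definition fps_mul f g : fps A := fun n => \sum_(i < n.+1) f i * g (n - i)%N.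

(* The coefficients n, n - 1, .., 0 of 1 / f, in this order. *)
Fixpoint fps_inv_seq f (n : nat) : seq A :=
  if n is m.+1 then
    let s := fps_inv_seq f m in
    - ((f 0%N)^-1 * \sum_(i < m.+1) f i.+1 * s`_i) :: s
  else [:: (f 0%N)^-1].

(* The multiplicative inverse of f, meaningful if f 0 is a unit a unit of A. *)
Definition fps_inv f : fps A := fun n => head 0 (fps_inv_seq f n).

Definition fps_div f g : fps A := fps_mul f (fps_inv g).

(* exp (c t) *)
Definition fps_exp (c : A) : fps A := fun n => c ^+ n / n`!%:R.

(* The k-th coefficient of f in the basis t ^ k / k!. *)
Definition egf_coef f (k : nat) : A := k`!%:R * f k.

(* <f(t) | h(x)> *)
Definition umbral f (h : {poly A}) : A :=
  \sum_(k < size h) h`_k * egf_coef f k.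

(* 2 / (w exp(t) + 1) *)
Definition euler_gf (w : A) : fps A :=
  fps_div (fps_const 2)
    (fps_add (fps_mul (fps_const w) (fps_exp 1)) (fps_const 1)).

Lemma fps_inv_seqE f n k : (k <= n)%N ->
  (fps_inv_seq f n)`_k = fps_inv f (n - k)%N.
Proof.
elim: n k => [|n IHn] [|k] //= kn.
by rewrite IHn // subSS.
Qed.

Lemma fps_mulV f : f 0%N \is a GRing.unit ->
  fps_mul f (fps_inv f) =1 fps_const 1.
Proof.
move=> f0 [|n]; rewrite /fps_mul.
  by rewrite big_ord1 /fps_inv /= divrr.
rewrite big_ord_recl /= subn0 {1}/fps_inv /= mulrN mulrA divrr // mul1r.
apply/eqP; rewrite addrC subr_eq0; apply/eqP; apply: eq_bigr => i _.
by rewrite fps_inv_seqE -1?ltnS // /bump /= add1n subSS.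
Qed.

End fps.

(* E_{n,w}(x), a polynomial in x: n! times the coefficient of t ^ n in
   2 / (w exp(t) + 1) * exp(x t), computed in K[x][[t]]. *)
Definition weighted_euler_poly {K : fieldType} (w : K) (n : nat) : {poly K} :=
  egf_coef (fps_mul (euler_gf w%:P) (fps_exp 'X)) n.

Definition weighted_euler_number {K : fieldType} (w : K) (n : nat) : K :=
  (weighted_euler_poly w n).[0].

(* \int w ^ a exp(a t) d mu_{-1}(a) *)
Definition fermionic_egf {R : realType} {p : nat} {K : padicValuedFieldType R p}
    (w : K) : fps K :=
  fun n => fermionic_integral (fun a : padic_int K => padic_pow w a * val a ^+ n)
           / n`!%:R.

(* Main.v *)
Require Import Defs.
From mathcomp Require Import all_boot all_order all_algebra.
From mathcomp Require Import all_classical all_reals all_analysis.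
From mathcomp Require Import ring.
Import Order.TTheory GRing.Theory Num.Theory.
Import numFieldNormedType.Exports.
Local Open Scope classical_set_scope.
Local Open Scope ring_scope.

(** Put [S_N(n) = \sum_(a < p^N) (-1)^a w^a a^n].  Since [p^N] is odd, the sum of
    [(-1)^a (g(a+1) + g(a))] over [a < p^N] telescopes to [g(0) + g(p^N)];
    for [g(a) = w^a a^n] this reads
    [w \sum_(k <= n) 'C(n, k) S_N(k) + S_N(n) = 0^n + w^(p^N) p^(N n)].
    The right-hand side tends to [2] if [n = 0] and to [0] otherwise, and
    [|w + 1| = |2| = 1], so by induction on [n] the sequence [S_N(n)] converges,
    and its limits satisfy the recurrence of the coefficients of
    [2 / (w e^t + 1)].  All claims follow by linearity and uniqueness of limits. *)

(** * Formal power series under ring morphisms *)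

Section fps_morphism.
Context {A B : comUnitRingType} (phi : {rmorphism A -> B}).
Implicit Types f g : fps A.

Lemma fps_inv_morph f : f 0%N \is a GRing.unit ->
  phi \o fps_inv f =1 fps_inv (phi \o f).
Proof.
move=> f0.
have E n : map phi (fps_inv_seq f n) = fps_inv_seq (phi \o f) n.
  elim: n => [|n IHn] /=; first by rewrite rmorphV.
  rewrite -IHn rmorphN rmorphM rmorphV // rmorph_sum; congr (- (_ * _) :: _).
  apply: eq_bigr => i _; rewrite rmorphM; congr (_ * _).
  rewrite (nth_map 0) // -(size_map phi) IHn.
  by have -> : size (fps_inv_seq (phi \o f) n) = n.+1 by elim: (n) => //= m ->.
move=> n /=; rewrite /fps_inv -E.
by case: (fps_inv_seq f n) => //=; rewrite rmorph0.
Qed.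

Lemma fps_mul_morph f g : phi \o fps_mul f g =1 fps_mul (phi \o f) (phi \o g).
Proof.
by move=> n /=; rewrite /fps_mul rmorph_sum; apply: eq_bigr => i _; rewrite rmorphM.
Qed.

End fps_morphism.

(** * Ring laws of formal power series *)

Section fps_ext.
Context {A : comUnitRingType}.
Implicit Types f g : fps A.

Lemma fps_mulC f g : fps_mul f g =1 fps_mul g f.
Proof.
move=> n; rewrite /fps_mul (reindex_inj rev_ord_inj) /=; apply: eq_bigr => i _.
by rewrite mulrC subSS subKn // -ltnS.
Qed.

(** Coefficients up to degree [n] depend only on the truncations at degree [n], and these are
    polynomials, whose product is associative. *)
Lemma fps_mulA f g h : fps_mul f (fps_mul g h) =1 fps_mul (fps_mul f g) h.
Proof.
move=> n.
pose t (k : fps A) : {poly A} := \poly_(i < n.+1) k i.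
have E k l (i : 'I_n.+1) : fps_mul k l i = (t k * t l)`_i.
  rewrite coefM; apply: eq_bigr => j _; rewrite !coef_poly.
  have jn : (j < n.+1)%N by apply: leq_trans (ltn_ord j) _; exact: ltn_ord.
  by rewrite jn ltnS (leq_trans (leq_subr _ _)) // -ltnS.
transitivity ((t f * (t g * t h))`_n).
  rewrite coefM; apply: eq_bigr => j _; rewrite coef_poly ltn_ord.
  have jn : (n - j < n.+1)%N by rewrite ltnS leq_subr.
  by rewrite (E g h (Ordinal jn)).
rewrite mulrA coefM; apply: eq_bigr => j _.
by rewrite E coef_poly ltnS leq_subr.
Qed.

Lemma fps_mulr1 f : fps_mul f (fps_const 1) =1 f.
Proof.
move=> n; rewrite /fps_mul big_ord_recr /= subnn mulr1 big1 ?add0r // => i _.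
by case: (n - i)%N (ltn_ord i) (subn_gt0 i n) => [|m] -> //; rewrite mulr0.
Qed.

Lemma eq_fps_mul f f' g g' : f =1 f' -> g =1 g' -> fps_mul f g =1 fps_mul f' g'.
Proof. by move=> ff gg n; apply: eq_bigr => i _; rewrite ff gg. Qed.

Lemma eq_fps_inv f g : f =1 g -> fps_inv f =1 fps_inv g.
Proof. by move=> /funext ->. Qed.

Lemma fps_divK f g : g 0%N \is a GRing.unit -> fps_mul (fps_div f g) g =1 f.
Proof.
move=> g0 n; rewrite /fps_div -fps_mulA -[RHS]fps_mulr1.
apply: eq_fps_mul => // m; rewrite fps_mulC; exact: fps_mulV.
Qed.

Lemma umbralXn f n : umbral f 'X^n = egf_coef f n.
Proof.
rewrite /umbral size_polyXn big_ord_recr /= coefXn eqxx mul1r big1 ?add0r // => i _.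
by rewrite coefXn (ltn_eqF (ltn_ord i)) mul0r.
Qed.

End fps_ext.

(** * The series 2 / (w e^t + 1) and the weighted Euler numbers *)

Section weighted_euler.
Context {K : fieldType} (w : K).
Context (w1_neq0 : w + 1 != 0).

Let den : fps K := fps_add (fps_mul (fps_const w) (fps_exp 1)) (fps_const 1).

Let denE n : den n = w / n`!%:R + (n == 0%N)%:R.
Proof.
rewrite /den /fps_add fps_mulC; congr (_ + _); last by case: n.
rewrite /fps_mul big_ord_recr /= subnn big1 => [|i _].
  by rewrite add0r /fps_exp expr1n mul1r mulrC.
by case: (n - i)%N (ltn_ord i) (subn_gt0 i n) => [|m] -> //; rewrite mulr0.
Qed.

Let den0 : den 0%N \is a GRing.unit.
Proof. by rewrite denE fact0 divr1 eqxx unitfE. Qed.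

(** Compare the coefficients of t^n in (w e^t + 1) g(t) = 2, multiply by n!, and isolate the term k
    = n, whose factor is w + 1. *)
Lemma euler_gf_rec n : (forall m, (m`!%:R : K) != 0) ->
  (w + 1) * egf_coef (euler_gf w) n =
  (if n is 0%N then 2 else 0) -
  w * \sum_(k < n) 'C(n, k)%:R * egf_coef (euler_gf w) k.
Proof.
move=> fact_neq0; have := fps_divK (fps_const 2) den den0 n.
rewrite -[fps_div _ _]/(euler_gf w) /fps_mul big_ord_recr /= subnn denE fact0 divr1 eqxx.
move=> /(congr1 (fun x => n`!%:R * x)).
have -> : n`!%:R * fps_const 2 n = (if n is 0%N then 2 else 0) :> K.
  by case: n => [|n] /=; rewrite ?fact0 ?mul1r ?mulr0.
move=> <-; rewrite mulrDr [X in X + _ - _]mulr_sumr mulr_sumr.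
rewrite (eq_bigr (fun k : 'I_n => w * ('C(n, k)%:R * egf_coef (euler_gf w) k))).
  by rewrite addrAC subrr add0r /egf_coef mulrC mulrA.
move=> k _; rewrite denE subn_eq0 leqNgt ltn_ord addr0 /egf_coef.
(* Writing n! as C(n, k) k! (n - k)! cancels the denominator (n - k)! of the exponential. *)
rewrite -(bin_fact (ltnW (ltn_ord k))) !natrM.
by field; rewrite !fact_neq0.
Qed.

(** Euler polynomials are computed over K[x]; the denominator has constant coefficients, and
    inversion commutes with the embedding of K in K[x]. *)
Lemma euler_gf_polyC n : euler_gf w%:P n = (euler_gf w n)%:P.
Proof.
rewrite /euler_gf /fps_div -[RHS]/((polyC \o fps_mul (fps_const 2) (fps_inv den)) n).
rewrite fps_mul_morph; apply: eq_fps_mul => {}n.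
  by case: n => [|n] /=; rewrite ?polyC0 // polyCMn.
rewrite fps_inv_morph //; apply: eq_fps_inv => {}n /=.
rewrite denE /fps_add fps_mulC polyCD; congr (_ + _); last first.
  by case: n => [|n].
rewrite /fps_mul big_ord_recr /= subnn big1 => [|i _].
  by rewrite add0r /fps_exp expr1n mul1r polyCM mulrC -polyCV polyCMn.
by case: (n - i)%N (ltn_ord i) (subn_gt0 i n) => [|m] -> //; rewrite mulr0.
Qed.

(** At x = 0 the series e^(xt) reduces to its constant term 1. *)
Lemma weighted_euler_numberE n :
  weighted_euler_number w n = egf_coef (euler_gf w) n.
Proof.
rewrite /weighted_euler_number /weighted_euler_poly /egf_coef hornerM.
rewrite -polyC_natr hornerC; congr (_ * _).
rewrite /fps_mul big_ord_recr /= hornerD horner_sum big1 => [|i _]; last first.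
  rewrite hornerM /fps_exp hornerM hornerXn expr0n subn_eq0 leqNgt ltn_ord.
  by rewrite mul0r mulr0.
rewrite add0r subnn euler_gf_polyC /fps_exp expr0 fact0 divr1 mulr1.
by rewrite hornerC.
Qed.

End weighted_euler.

(** * The ultrametric absolute value and convergence *)

Section padic_valued.
Context {R : realType} {p : nat} {K : padicValuedFieldType R p}.
Context (p_prime : prime p).
Implicit Types x y l : K.

Lemma vabs0 : vabs (0 : K) = 0.
Proof. exact/vabs_eq0. Qed.

Lemma vabs_mul x y : vabs (x * y) = vabs x * vabs y.
Proof. exact: vabsM. Qed.

Lemma vabsN x : vabs (- x) = vabs x.
Proof.
rewrite -mulN1r vabs_mul.
have /eqP : vabs (-1 : K) ^+ 2 = 1 by rewrite expr2 -vabs_mul mulrNN mulr1 vabs1.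
rewrite sqrf_eq1 => /orP[/eqP->|/eqP E]; first by rewrite mul1r.
by have := vabs_ge0 (-1 : K); rewrite E ler0N1.
Qed.

Lemma vabsX x n : vabs (x ^+ n) = vabs x ^+ n.
Proof. by elim: n => [|n IHn]; rewrite ?vabs1 // !exprS vabs_mul IHn. Qed.

Lemma vabs_add_le x y e : vabs x <= e -> vabs y <= e -> vabs (x + y) <= e.
Proof. by move=> xe ye; rewrite (le_trans (vabs_ultra _ _)) // ge_max xe. Qed.

Lemma vabs_sum_le I (s : seq I) (F : I -> K) e : 0 <= e ->
  (forall i, vabs (F i) <= e) -> vabs (\sum_(i <- s) F i) <= e.
Proof.
move=> e0 Fe; elim: s => [|i s IHs]; first by rewrite big_nil vabs0.
by rewrite big_cons vabs_add_le.
Qed.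

Lemma invp_lt1 : (p%:R^-1 : R) < 1.
Proof. by rewrite invf_lt1 ?ltr0n ?ltr1n ?prime_gt0 ?prime_gt1. Qed.

(* From a Bezout relation [u m = v p + 1] and the ultrametric inequality, [|u| |m| = 1]. *)
Lemma vabs_nat_coprime m : coprime m p -> vabs (m%:R : K) = 1.
Proof.
move=> mp; apply/le_anti; rewrite vabs_nat /= leNgt; apply/negP => m1.
have m0 : (0 < m)%N.
  case: m mp {m1} => //; rewrite /coprime gcd0n => /eqP E.
  by have := prime_gt1 p_prime; rewrite E.
case: (egcdnP p m0) => u v E _; move: mp E; rewrite /coprime => /eqP ->.
move=> /(congr1 (fun n => n%:R : K)); rewrite natrD !natrM => E.
have : vabs (1 : K) <= Num.max (vabs (m%:R : K)) p%:R^-1.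
  rewrite [X in vabs X <= _](_ : 1 = u%:R * m%:R + - (v%:R * p%:R)).
    2: by rewrite E; ring.
  apply: vabs_add_le; rewrite ?vabsN vabs_mul le_max.
    by rewrite ler_piMl ?vabs_ge0 ?vabs_nat.
  by rewrite vabs_p ler_piMl ?invr_ge0 ?ler0n ?vabs_nat // orbT.
by rewrite vabs1 leNgt gt_max m1 invp_lt1.
Qed.

(** In n + 1 = m p^k with m prime to p, neither factor vanishes: |m| = 1 and |p| = 1/p. *)
Lemma padic_char0 n : (n.+1%:R : K) != 0.
Proof.
have p0 : (p%:R : K) != 0.
  apply/eqP => /vabs_eq0; rewrite vabs_p => /eqP.
  by rewrite invr_eq0 pnatr_eq0 eqn0Ngt prime_gt0.
have [m mp ->] := pfactor_coprime p_prime (ltn0Sn n).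
rewrite natrM natrX mulf_neq0 ?expf_neq0 //; apply/eqP => /vabs_eq0/eqP.
by rewrite vabs_nat_coprime ?oner_eq0 // coprime_sym.
Qed.

Lemma padic_fact_neq0 n : (n`!%:R : K) != 0.
Proof. by rewrite -(prednK (fact_gt0 n)) padic_char0. Qed.

(** This moves convergence from the uniform structure to real sequences, where squeezing and sums of
    limits are available. *)
Lemma padic_cvgP (u : nat -> K) l :
  (u n @[n --> \oo] --> l) <-> (vabs (l - u n) @[n --> \oo] --> (0 : R)).
Proof.
split=> ul.
  apply/cvgr0Pnorm_lt => e e0.
  move/cvg_entourageP: ul => /(_ [set xy | vabs (xy.1 - xy.2) < e]).
  case=> [|M _ Mu]; first by rewrite entourage_vabs; exists e.
  exists M => // n /Mu /=.
  by rewrite ger0_norm ?vabs_ge0.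
apply/cvg_entourageP => A; rewrite entourage_vabs => -[e e0 eA].
move/cvgr0Pnorm_lt: ul => /(_ _ e0) [M _ Mu]; exists M => // n /Mu /= ne.
by apply: eA => /=; rewrite -[ltLHS]ger0_norm ?vabs_ge0.
Qed.

Lemma padic_cvg_unique (u : nat -> K) l l' :
  u n @[n --> \oo] --> l -> u n @[n --> \oo] --> l' -> l = l'.
Proof.
move=> /padic_cvgP ul /padic_cvgP ul'.
apply/subr0_eq/vabs_eq0/le_anti; rewrite vabs_ge0 andbT.
have c : vabs (l - u n) + vabs (l' - u n) @[n --> \oo] --> (0 : R).
  by rewrite -[X in _ --> X]addr0; apply: cvgD.
rewrite -(cvg_lim (@Rhausdorff R) c); apply: limr_ge; first by apply/cvg_ex; exists 0.
near=> n.
have -> : l - l' = (l - u n) + - (l' - u n) by ring.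
by apply: vabs_add_le; rewrite ?vabsN ?lerDl ?lerDr ?vabs_ge0.
Unshelve. all: by end_near. Qed.

(** Once a limit is exhibited, uniqueness excludes both another choice and the default value 0. *)
Lemma padic_limE (u : nat -> K) l : u n @[n --> \oo] --> l -> padic_lim u = l.
Proof.
by move=> ul; apply: xget_unique => // l' /= ul'; apply: padic_cvg_unique ul' ul.
Qed.

Lemma padic_cvgD (u v : nat -> K) l m :
  u n @[n --> \oo] --> l -> v n @[n --> \oo] --> m ->
  u n + v n @[n --> \oo] --> l + m.
Proof.
move=> /padic_cvgP ul /padic_cvgP vm; apply/padic_cvgP.
have c : vabs (l - u n) + vabs (m - v n) @[n --> \oo] --> (0 : R).
  by rewrite -[X in _ --> X]addr0; apply: cvgD.
apply: squeeze_cvgr (cvg_cst _) c.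
near=> n; rewrite vabs_ge0 /= opprD addrACA.
by apply: vabs_add_le; rewrite ?lerDl ?lerDr ?vabs_ge0.
Unshelve. all: by end_near. Qed.

Lemma padic_cvgZ c (u : nat -> K) l :
  u n @[n --> \oo] --> l -> c * u n @[n --> \oo] --> c * l.
Proof.
move=> /padic_cvgP ul; apply/padic_cvgP.
have : vabs c * vabs (l - u n) @[n --> \oo] --> (0 : R).
  by rewrite -[X in _ --> X](mulr0 (vabs c)); apply: cvgMl_tmp.
by under eq_fun do rewrite -vabs_mul mulrBr.
Qed.

Lemma padic_cvg_sum n (u : 'I_n -> nat -> K) (l : 'I_n -> K) :
  (forall i, u i N @[N --> \oo] --> l i) ->
  \sum_(i < n) u i N @[N --> \oo] --> \sum_(i < n) l i.
Proof.
elim: n u l => [|n IHn] u l ul.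
  rewrite big_ord0; under eq_fun do rewrite big_ord0.
  exact: cvg_cst.
rewrite big_ord_recl; under eq_fun do rewrite big_ord_recl.
by apply: padic_cvgD => //; apply: IHn.
Qed.

(** * Powers of w at natural numbers, and limits along p^N *)

Lemma gbinom_nat n k : gbinom (n%:R : K) k = 'C(n, k)%:R.
Proof.
apply: (mulIf (padic_fact_neq0 k)); rewrite /gbinom divfK ?padic_fact_neq0 //.
rewrite -natrM bin_ffact ffact_prod natr_prod.
have [kn|nk] := leqP k n.
  by apply: eq_bigr => i _; rewrite natrB // (leq_trans (ltnW (ltn_ord i))).
(* When n < k, both products contain a zero factor at index n. *)
rewrite (bigD1 (Ordinal nk)) //= subrr mul0r; apply/esym.
by rewrite (bigD1 (Ordinal nk)) //= subnn mul0r.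
Qed.

(** Fermionic sums sample the integrand at natural numbers only; there the binomial series stops at
    k = n and is the binomial theorem for (1 + (w - 1))^n. *)
Lemma padic_pow_nat (w : K) n : padic_pow w (padic_int_nat n) = w ^+ n.
Proof.
apply: padic_limE; apply: cvg_near_cst; exists n.+1 => // m /= nm.
rewrite /series /= (big_cat_nat (n := n.+1)) //=.
rewrite [X in _ + X]big1_seq => [|k]; last first.
  by rewrite mem_index_iota gbinom_nat => /and3P[_ nk _]; rewrite bin_small ?mul0r.
rewrite addr0 big_mkord -[in RHS](subrK 1 w) addrC exprD1n.
by apply: eq_bigr => k _; rewrite gbinom_nat mulr_natl.
Qed.

(* [x^p - 1 = (x - 1) (p + \sum_(i < p) (x^i - 1))], and both [p] and the
   [x^i - 1] have absolute value at most [r = max(1/p, |1 - w|) < 1]. *)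
Lemma cvg_expr_prime_power (w : K) : vabs (1 - w) < 1 ->
  w ^+ (p ^ N) @[N --> \oo] --> (1 : K).
Proof.
move=> w1; pose r := Num.max p%:R^-1 (vabs (1 - w)).
have r1 : r < 1 by rewrite gt_max invp_lt1.
have r0 : 0 <= r by rewrite le_max vabs_ge0 orbT.
(* Each p-th power gains a factor r; the exponent starts at 1 because |w - 1| <= r. *)
have le_r N : vabs (w ^+ (p ^ N) - 1) <= r ^+ N.+1.
  elim: N => [|N IHN]; first by rewrite expn0 expr1 -opprB vabsN le_max lexx orbT.
  set x := w ^+ (p ^ N) in IHN *.
  have xr : vabs (x - 1) <= r.
    by rewrite (le_trans IHN) // exprS ler_piMr // exprn_ile1 // ltW.
  rewrite expnSr exprM -/x subrX1 vabs_mul exprSr ler_pM ?vabs_ge0 //.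
  have -> : \sum_(i < p) x ^+ i = p%:R + \sum_(i < p) (x ^+ i - 1).
    by rewrite sumrB sumr_const card_ord addrC subrK.
  apply: vabs_add_le; first by rewrite vabs_p le_max lexx.
  (* Here x - 1 divides x^i - 1, and the cofactor has absolute value at most 1 because |x| <= 1. *)
  apply: vabs_sum_le => // i; rewrite subrX1 vabs_mul.
  apply: (le_trans _ xr); rewrite ler_piMr ?vabs_ge0 //.
  apply: vabs_sum_le => // j; rewrite vabsX exprn_ile1 ?vabs_ge0 //.
  rewrite -[x](subrK 1); apply: vabs_add_le; last by rewrite vabs1.
  exact: le_trans xr (ltW r1).
apply/padic_cvgP.
apply: (@squeeze_cvgr _ _ _ _ (cst 0) (fun N => r ^+ N)); [|exact: cvg_cst|].
  near=> N; rewrite vabs_ge0 -opprB vabsN (le_trans (le_r N)) //=.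
  by rewrite exprS ler_piMl ?exprn_ge0 // ltW.
by apply: cvg_expr; rewrite ger0_norm.
Unshelve. all: by end_near. Qed.

Lemma cvg_prime_powerX n : (0 < n)%N -> (p ^ N)%:R ^+ n @[N --> \oo] --> (0 : K).
Proof.
move=> n0; apply/padic_cvgP.
apply: (@squeeze_cvgr _ _ _ _ (cst 0) (fun N => p%:R^-1 ^+ N)); [|exact: cvg_cst|].
  near=> N; rewrite vabs_ge0 sub0r vabsN vabsX natrX vabsX vabs_p /=.
  rewrite -exprM; apply: ler_wiXn2l; rewrite ?invr_ge0 ?ler0n ?leq_pmulr //.
  exact/ltW/invp_lt1.
by apply: cvg_expr; rewrite ger0_norm ?invr_ge0 ?ler0n ?invp_lt1.
Unshelve. all: by end_near. Qed.

Lemma sum_sign_telescope (g : nat -> K) M : odd M ->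
  \sum_(0 <= a < M) (g a.+1 + g a) * (-1) ^+ a = g 0%N + g M.
Proof.
move=> oM.
(* With the sign (-1)^M the identity holds for every M, so the induction can drop parity. *)
have -> : g 0%N + g M = g 0%N - (-1) ^+ M * g M by rewrite -signr_odd oM expr1; ring.
elim: M {oM} => [|M IHM]; first by rewrite big_geq // expr0; ring.
by rewrite big_nat_recr //= IHM exprS; ring.
Qed.

(** * Convergence of the moments S_N(n) and the integral of a polynomial *)

Section moments.
Context (p_odd : odd p) (w : K) (w_near1 : vabs (1 - w) < 1).

Let moment n N : K := \sum_(0 <= a < p ^ N) w ^+ a * a%:R ^+ n * (-1) ^+ a.

(** As p is odd, |2| = 1; in 2 = (w + 1) + (1 - w) the second summand is smaller than 1, so the
    first cannot be. *)
Lemma vabs_addw1 : vabs (w + 1) = 1.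
Proof.
have v2 : vabs (2 : K) = 1 by rewrite vabs_nat_coprime // coprime2n.
apply/le_anti/andP; split.
  have -> : w + 1 = 2 + - (1 - w) by ring.
  by apply: vabs_add_le; rewrite ?vabsN ?v2 // ltW.
rewrite leNgt; apply/negP => w1.
have : vabs (2 : K) <= Num.max (vabs (w + 1)) (vabs (1 - w)).
  have -> : (2 : K) = (w + 1) + (1 - w) by ring.
  exact: vabs_ultra.
by rewrite v2 leNgt gt_max w1 w_near1.
Qed.

Lemma addw1_neq0 : w + 1 != 0.
Proof. by apply/eqP => /vabs_eq0/eqP; rewrite vabs_addw1 oner_eq0. Qed.

(** The telescoped value g(0) + g(p^N) for g(a) = w^a a^n, with 0^0 = 1. *)
Let boundary n N : K := (0%:R ^+ n) + w ^+ (p ^ N) * (p ^ N)%:R ^+ n.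

Lemma moment_rec n N :
  (w + 1) * moment n N = boundary n N - w * \sum_(k < n) 'C(n, k)%:R * moment k N.
Proof.
have oM : odd (p ^ N) by rewrite oddX p_odd orbT.
have := sum_sign_telescope (fun a => w ^+ a * a%:R ^+ n) _ oM.
rewrite expr0 mul1r -/(boundary n N) => <-.
(* The term k = n of the full sum supplies the w in the factor w + 1. *)
transitivity (w * (\sum_(k < n.+1) 'C(n, k)%:R * moment k N) + moment n N -
    w * \sum_(k < n) 'C(n, k)%:R * moment k N).
  by rewrite big_ord_recr /= binn; ring.
congr (_ - _); under eq_bigr do rewrite mulr_sumr.
rewrite exchange_big /= mulr_sumr -big_split /=; apply: eq_bigr => a _.
(* Expanding (a + 1)^n by the binomial theorem produces the lower moments. *)
rewrite -natr1 addrC exprD1n exprS mulrDl addrC; congr (_ + _).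
rewrite !mulr_sumr mulr_suml; apply: eq_bigr => k _; rewrite -mulr_natl; ring.
Qed.

Lemma cvg_boundary n :
  boundary n N @[N --> \oo] --> (if n is 0%N then 2 else 0 : K).
Proof.
case: n => [|n].
  under eq_fun do rewrite /boundary !expr0 mulr1.
  by apply: padic_cvgD; [exact: cvg_cst|exact: cvg_expr_prime_power].
rewrite -[X in _ --> X]addr0; apply: padic_cvgD; first by rewrite expr0n; exact: cvg_cst.
have /padic_cvgP := cvg_prime_powerX n.+1 isT => c; apply/padic_cvgP.
apply: squeeze_cvgr c; last exact: cvg_cst.
near=> N; rewrite vabs_ge0 !sub0r !vabsN vabs_mul ler_piMl ?vabs_ge0 //.
rewrite vabsX exprn_ile1 ?vabs_ge0 //.
have -> : w = 1 - (1 - w) by ring.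
by apply: vabs_add_le; rewrite ?vabs1 ?vabsN // ltW.
Unshelve. all: by end_near. Qed.

(** By strong induction, [moment_rec] passes to the limit and becomes [euler_gf_rec]; then divide by
    w + 1. *)
Lemma cvg_moment n : moment n N @[N --> \oo] --> egf_coef (euler_gf w) n.
Proof.
elim/ltn_ind: n => n IHn.
have c : boundary n N - w * \sum_(k < n) 'C(n, k)%:R * moment k N @[N --> \oo] -->
    (w + 1) * egf_coef (euler_gf w) n.
  rewrite euler_gf_rec; [|exact: addw1_neq0|exact: padic_fact_neq0].
  apply: padic_cvgD; first exact: cvg_boundary.
  rewrite -mulNr; under eq_fun do rewrite -mulNr.
  by apply/padic_cvgZ/padic_cvg_sum => k; apply/padic_cvgZ/IHn.
rewrite -[X in _ --> X](mulKf addw1_neq0).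
under eq_fun do rewrite -[moment _ _](mulKf addw1_neq0) moment_rec.
exact: padic_cvgZ.
Qed.

Lemma fermionic_integral_poly (h : {poly K}) :
  fermionic_integral (fun a : padic_int K => padic_pow w a * h.[val a]) =
  umbral (euler_gf w) h.
Proof.
apply: padic_limE.
have -> : fermionic_sum (fun a : padic_int K => padic_pow w a * h.[val a]) =
    fun N => \sum_(k < size h) h`_k * moment k N.
  apply/funext => N; rewrite /fermionic_sum.
  under [RHS]eq_bigr do rewrite mulr_sumr.
  rewrite exchange_big /=; apply: eq_bigr => a _.
  rewrite padic_pow_nat horner_coef mulr_sumr mulr_suml; apply: eq_bigr => k _ /=.
  ring.
by apply: padic_cvg_sum => k; apply/padic_cvgZ/cvg_moment.
Qed.

(** The case h = x^n of the previous lemma, divided by n!. *)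
Lemma fermionic_egfE : fermionic_egf w =1 euler_gf w.
Proof.
move=> n; rewrite /fermionic_egf.
have := fermionic_integral_poly 'X^n; rewrite umbralXn => E.
under eq_fun do rewrite -hornerXn.
by rewrite E /egf_coef mulrC mulKf ?padic_fact_neq0.
Qed.

End moments.
End padic_valued.

Theorem theorem2p4 (R : realType) (p : nat) (p_prime : prime p) (p_odd : odd p)
    (Cp : padicComplexType R p) (w : Cp) (w_near1 : vabs (1 - w) < 1) :
  (forall h : {poly Cp},
     umbral (fermionic_egf w) h =
     fermionic_integral (fun a : padic_int Cp => padic_pow w a * h.[val a])) /\
  (forall h : {poly Cp},
     umbral (euler_gf w) h =
     fermionic_integral (fun a : padic_int Cp => padic_pow w a * h.[val a])) /\
  (forall n : nat,
     weighted_euler_number w n = umbral (fermionic_egf w) 'X^n).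
Proof.
(* With the two series identified, the first two claims coincide. *)
have -> : fermionic_egf w = euler_gf w by apply/funext/fermionic_egfE.
split; last split; [by move=> h; rewrite fermionic_integral_poly..|] => n.
by rewrite umbralXn weighted_euler_numberE // addw1_neq0.
Qed.
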